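(* Let $n$ be an odd integer with $n \ge 27$ and $n \notin \{33,35,37,41,43,47,51\}$. Then there exists an idempotent symmetric latin square $L$ of order $n$ such that for every row index $r$, column index $c$ and symbol $s$, there is a proper latin subsquare of $L$ whose rows include $r$, whose columns include $c$, and whose symbols include $s$.
   Context: A latin square of order $n$ is an $n\times n$ array with entries from $[n]=\{1,\dots,n\}$ in which every row and every column is a permutation of $[n]$; rows and columns are indexed by $[n]$. It is symmetric if $L_{ij} = L_{ji}$ for all $i,j$, and idempotent if $L_{ii} = i$ for all $i$. A latin subsquare is a sub-array determined by a set $R$ of rows and a set $C$ of columns (not necessarily contiguous) which is itself a latin square on some set of $|R| = |C|$ symbols; it is proper if it is not the whole square. *)

(* Defs.v *)
From mathcomp Require Import all_boot.
Set Implicit Arguments. Unset Strict Implicit. Unset Printing Implicit Defensive.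

Definition latin_square (n : nat) (L : 'I_n -> 'I_n -> 'I_n) : Prop :=
  (forall i, injective (L i)) /\ (forall j, injective (fun i => L i j)).

Definition symmetric_ls (n : nat) (L : 'I_n -> 'I_n -> 'I_n) : Prop :=
  forall i j, L i j = L j i.

Definition idempotent_ls (n : nat) (L : 'I_n -> 'I_n -> 'I_n) : Prop :=
  forall i, L i i = i.

Definition latin_subsquare (n : nat) (L : 'I_n -> 'I_n -> 'I_n)
    (R C S : {set 'I_n}) : Prop :=
  [/\ #|R| = #|C|, #|S| = #|R|,
      (forall r, r \in R -> [set L r c | c in C] = S) &
      (forall c, c \in C -> [set L r c | r in R] = S)].

Definition proper_subsquare (n : nat) (R C : {set 'I_n}) : Prop :=
  ~ (R = [set: 'I_n] /\ C = [set: 'I_n]).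

(* Main.v *)
Require Import Defs.
From mathcomp Require Import all_boot.
From mathcomp Require Import zify.

Set Implicit Arguments. Unset Strict Implicit. Unset Printing Implicit Defensive.

(**
A subsquare may use different sets of rows and columns, and this makes very
small squares eligible: in Z_3^2 with [x y = -x-y] the triple [(r, c, s)] lies
in the subsquare on the cosets [r + H], [c + H] of the line [H] spanned by
[r + c + s], and in the Fano plane every triple lies in a line or in an
intercalate [{r, r+d} x {c, c+d}].  So orders 7 and 9 have the covering
property, with subsquares for which either the rows, columns and symbols
coincide or the rows and columns are disjoint.

A covered square of order [m] inflates to order [m h + w]: replace every point
by [h] copies, adjoin [w] common points, and put on each set of copies together
with the [w] points a commutative idempotent square of order [h + w] that has a
subsquare on the [w] points.  Such squares with [h] even and [w] odd,
[w] at most about [h/2], come from a cyclic construction on Z_h, and [n = 7 h + w] then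
reaches every odd [n >= 183].  The smaller orders come from the bases 7, 9 and a
few orders already obtained, with the exception of 53, 65, 67, 69 and 83.  These
are three-dimensional: any three points lie in a proper flat of a geometry built
on PG(3,4), AG(3,3) or PG(3,3), and they are verified by computation.
*)

(** * Commutative idempotent operations and the covering property *)

Definition ci_op (T : Type) (op : T -> T -> T) :=
  [/\ forall x, injective (op x), commutative op & forall x, op x x = x].

(** Closure suffices: injectivity and equal cardinalities turn inclusion in [U] into equality. *)
Definition subsquare (T : finType) (op : T -> T -> T) (R C U : {set T}) :=
  [/\ #|R| = #|C|, #|U| = #|R|, {in R & C, forall r c, op r c \in U} &
      [/\ R = C, R = U & R != setT] \/ [disjoint R & C]].

Definition covering (T : finType) (op : T -> T -> T) :=
  forall r c u, exists R C U,
    [/\ subsquare op R C U, r \in R, c \in C & u \in U].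

Definition covered n := exists T : finType, #|T| = n /\
  exists2 op : T -> T -> T, ci_op op & covering op.

Lemma covered_square n : covered n ->
  exists L : 'I_n -> 'I_n -> 'I_n,
    [/\ latin_square L, symmetric_ls L, idempotent_ls L &
      forall r c s : 'I_n,
        exists R C S : {set 'I_n},
          [/\ latin_subsquare L R C S, proper_subsquare R C,
              r \in R, c \in C & s \in S]].
Proof.
case=> T [<- [op [jop cop iop] cov]].
pose L (i j : 'I_#|T|) : 'I_#|T| := enum_rank (op (enum_val i) (enum_val j)).
have jL i : injective (L i) by move=> j k /enum_rank_inj/jop/enum_val_inj.
have cL i j : L i j = L j i by rewrite /L cop.
exists L; split=> // [|i|r c s].
- by split=> // j i k; rewrite ![L _ j]cL; apply: jL.
- by rewrite /L iop enum_valK.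
have [R [C [U [[cRC cUR cl pr] rR cC uU]]]] :=
  cov (enum_val r) (enum_val c) (enum_val s).
have inE' (A : {set T}) i : (i \in enum_rank @: A) = (enum_val i \in A).
  by rewrite -{1}[i]enum_valK mem_imset //; apply: enum_rank_inj.
have cardE (A : {set T}) : #|enum_rank @: A| = #|A|.
  by rewrite card_imset //; apply: enum_rank_inj.
exists (enum_rank @: R), (enum_rank @: C), (enum_rank @: U).
rewrite !inE'; split=> //.
  split; rewrite ?cardE // => x; rewrite inE' => xin.
    apply/eqP; rewrite eqEcard (card_imset _ (jL x)) !cardE cUR cRC leqnn andbT.
    by apply/subsetP=> _ /imsetP[y + ->]; rewrite !inE' enum_rankK => yC;
      apply: cl.
  apply/eqP; rewrite eqEcard cardE [X in _ <= X]card_in_imset;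
    rewrite ?cardE ?cUR ?leqnn ?andbT; last first.
    by move=> i j _ _; rewrite ![L _ x]cL => /jL.
  by apply/subsetP=> _ /imsetP[y + ->]; rewrite !inE' enum_rankK => yC;
      apply: cl.
case=> RT CT; case: pr => [[_ _ /negP[]]|/pred0P/(_ (enum_val r))].
  by apply/eqP/setP=> x; rewrite -[x]enum_rankK -inE' RT !inE.
by rewrite /= rR -inE' CT inE.
Qed.

(** * Inflation *)

Section Inflation.

Variables (M V W : finType) (f : M -> M -> M).
Variables (q : V + W -> V + W -> V + W) (g : V -> V -> V).
Hypotheses (ci_f : ci_op f) (ci_q : ci_op q).
Hypotheses (inj_g : forall x, injective (g x)) (comm_g : commutative g).
Hypothesis closed_q : forall a b, exists c, q (inr a) (inr b) = inr c.

Definition embed x (z : V + W) : M * V + W :=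
  match z with inl v => inl (x, v) | inr w => inr w end.

Definition inflate (a b : M * V + W) : M * V + W :=
  match a, b with
  | inl (x, v), inl (y, u) =>
      if x == y then embed x (q (inl v) (inl u)) else inl (f x y, g v u)
  | inl (x, v), inr w => embed x (q (inl v) (inr w))
  | inr w, inl (x, v) => embed x (q (inr w) (inl v))
  | inr w, inr w' => if q (inr w) (inr w') is inr w'' then inr w'' else inr w
  end.

Lemma embed_inj x : injective (embed x).
Proof. by case=> [u|w] [u'|w'] //= [->]. Qed.

(** Multiplication by [w] already permutes the common points, so no other point can be sent to
    one. *)
Lemma q_mixed w v : exists u, q (inr w) (inl v) = inl u.
Proof.
case: ci_q => jq _ _; case E: (q _ _) => [u|z]; first by exists u.
have jw : injective (fun w' => if q (inr w) (inr w') is inr w'' then w'' else w).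
  move=> a b; have [c Ec] := closed_q w a; have [d Ed] := closed_q w b.
  rewrite Ec Ed => cd; have := jq (inr w) (inr a) (inr b).
  by rewrite Ec Ed cd => /(_ erefl) [].
have := f_invF jw z; have [c Ec] := closed_q w (invF jw z); rewrite Ec => cz.
by have := jq (inr w) (inl v) (inr (invF jw z)); rewrite E Ec cz => /(_ erefl).
Qed.

Lemma inflate_ci : ci_op inflate.
Proof.
have [jf cf idf] := ci_f; have [jq cq idq] := ci_q; split.
- move=> [[x v]|w].
  + have off y z u : x != y -> embed x z <> inl (f x y, u).
      by case: z => //= v' /eqP xy [E _]; apply: xy; apply: (jf x); rewrite idf.
    move=> [[y u]|w] [[y' u']|w'] /=.
    * case: eqVneq => [<-|xy]; case: eqVneq => [<-|xy'].
      - by move/embed_inj/jq=> [->].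
      - by move/off => /(_ xy').
      - by move/esym/off => /(_ xy).
      - by case=> /jf-> /inj_g->.
    * by case: eqVneq => [<-|xy] => [/embed_inj/jq //|/esym/off] => /(_ xy).
    * by case: eqVneq => [<-|xy] => [/embed_inj/jq //|/off] => /(_ xy).
    * by move/embed_inj/jq=> [->].
  + move=> [[y u]|a] [[y' u']|a'] /=.
    * have [z Ez] := q_mixed w u; have [z' Ez'] := q_mixed w u'.
      rewrite Ez Ez' => -[-> zz'].
      by have := jq (inr w) (inl u) (inl u'); rewrite Ez Ez' zz' => /(_ erefl) [->].
    * by have [z ->] := q_mixed w u; have [c ->] := closed_q w a'.
    * by have [z ->] := q_mixed w u'; have [c ->] := closed_q w a.
    * have [c Ec] := closed_q w a; have [c' Ec'] := closed_q w a'.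
      rewrite Ec Ec' => -[cc'].
      by have := jq (inr w) (inr a) (inr a'); rewrite Ec Ec' cc' => /(_ erefl) [->].
- move=> [[x v]|w] [[y u]|w'] /=; rewrite 1?[q (inl v) _]cq 1?[q (inr w) _]cq //.
  + by rewrite eq_sym cf comm_g; case: eqP => // ->.
  + by have [c ->] := closed_q w' w.
- by move=> [[x v]|w] /=; rewrite ?eqxx idq.
Qed.

Definition inflate_set (A : {set M}) :=
  [set z : M * V + W | if z is inl (x, _) then x \in A else true].

Definition inflate_blocks (A : {set M}) :=
  [set z : M * V + W | if z is inl (x, _) then x \in A else false].

Lemma card_inflate_blocks A : #|inflate_blocks A| = #|A| * #|V|.
Proof.
have -> : inflate_blocks A = inl @: setX A [set: V].
  apply/setP=> -[[x v]|w]; rewrite !inE.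
    by rewrite mem_imset ?inE ?andbT //; apply: inl_inj.
  by apply/esym/imsetP=> -[].
by rewrite card_imset ?cardsX ?cardsT //; apply: inl_inj.
Qed.

Lemma inflate_covering : 0 < #|M| -> 0 < #|V| -> covering f -> covering inflate.
Proof.
move=> /card_gt0P[x0 _] /card_gt0P[v0 _] cov.
have flat (A : {set M}) : {in A &, forall x y, f x y \in A} -> A != setT ->
    subsquare inflate (inflate_set A) (inflate_set A) (inflate_set A).
  move=> clA pA; split=> //.
    move=> [[x v]|w] [[y u]|w']; rewrite !inE /=.
    - by case: eqP => [->|_ xA yA]; [case: (q _ _) => // ? | apply: clA].
    - by case: (q _ _).
    - by case: (q _ _).
    - by have [c ->] := closed_q w w'.
  left; split=> //; apply: contra pA => /eqP/setP E.
  by apply/eqP/setP=> x; have:= E (inl (x, v0)); rewrite !inE.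
(* A point that is both a row and a column excludes the disjoint case, so [cov x x y] yields a
   flat. *)
have pair x y : exists A : {set M},
    [/\ subsquare inflate (inflate_set A) (inflate_set A) (inflate_set A),
        x \in A & y \in A].
  have [R [C [U [[_ _ cl pr] xR xC yU]]]] := cov x x y.
  case: pr => [[RC RU pR]|/pred0P/(_ x)]; last by rewrite /= xR xC.
  by subst C U; exists R; split=> //; apply: flat.
(* Common points lie in every [inflate_set A], so a triple with one of them needs a flat through at
   most two points of [M]. *)
have solve r c u x y : (forall A : {set M}, x \in A -> y \in A ->
    [&& r \in inflate_set A, c \in inflate_set A & u \in inflate_set A]) ->
    exists R C U, [/\ subsquare inflate R C U, r \in R, c \in C & u \in U].
  have [A [sA xA yA]] := pair x y => /(_ A xA yA)/and3P[rA cA uA].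
  by exists (inflate_set A), (inflate_set A), (inflate_set A).
move=> [[x v]|w] [[y u]|w'] [[z t]|w''].
- have [R [C [U [[cRC cUR cl pr] xR yC zU]]]] := cov x y z.
  case: pr => [[RC RU pR]|dRC].
    subst C U; exists (inflate_set R), (inflate_set R), (inflate_set R).
    by rewrite !inE; split=> //; apply: flat.
  exists (inflate_blocks R), (inflate_blocks C), (inflate_blocks U).
  rewrite !inE; split=> //.
  split; rewrite ?card_inflate_blocks ?cUR ?cRC //.
    move=> [[a i]|?] [[b j]|?]; rewrite !inE //= => aR bC.
    case: eqP => [ab|_]; last exact: cl.
    by move/pred0P/(_ a): dRC; rewrite /= aR ab bC.
  right; apply/pred0P=> -[[a i]|?]; rewrite /= !inE //.
  by move/pred0P/(_ a): dRC.
- by apply: (solve _ _ _ x y) => A xA yA; rewrite !inE xA yA.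
- by apply: (solve _ _ _ x z) => A xA yA; rewrite !inE xA yA.
- by apply: (solve _ _ _ x x) => A xA yA; rewrite !inE xA.
- by apply: (solve _ _ _ y z) => A xA yA; rewrite !inE xA yA.
- by apply: (solve _ _ _ y y) => A xA yA; rewrite !inE xA.
- by apply: (solve _ _ _ z z) => A xA yA; rewrite !inE xA.
- by apply: (solve _ _ _ x0 x0) => A xA yA; rewrite !inE.
Qed.

End Inflation.

(** * Squares on initial segments of the integers *)

Definition ci_on n (f : nat -> nat -> nat) :=
  [/\ forall x y, x < n -> y < n -> f x y < n,
      forall x y, x < n -> y < n -> f x y = f y x,
      forall x, x < n -> f x x = x &
      forall x y z, x < n -> y < n -> z < n -> f x y = f x z -> y = z].

Lemma ci_on_op n f : ci_on n f ->
  exists2 op : 'I_n -> 'I_n -> 'I_n, ci_op op & forall i j, op i j = f i j :> nat.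
Proof.
move=> [bf cf idf jf].
have opE (i j : 'I_n) : insubd i (f i j) = f i j :> nat.
  by rewrite val_insubd bf.
exists (fun i j : 'I_n => insubd i (f i j)) => //.
split=> [i j k /(congr1 val)|i j|i].
- by rewrite /= !opE => /jf E; apply: val_inj; apply: E.
- by apply: val_inj; rewrite /= !opE cf.
- by apply: val_inj; rewrite /= opE idf.
Qed.

Definition incomplete h w := exists2 f, ci_on (h + w) f &
  forall x y, h <= x < h + w -> h <= y < h + w -> h <= f x y.

(* [a - b] modulo [h], for [a < b + h] *)
Definition wrap h a b := if a < b then a + h - b else a - b.

Lemma covered_inflate m h w : 0 < m -> 0 < h ->
  covered m -> incomplete h w -> covered (m * h + w).
Proof.
move=> m0 h0 [M [Mm [f cif covf]]] [q0 ciq0 clq0].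
have [q' [jq cq iq] q'E] := ci_on_op ciq0.
pose q (a b : 'I_h + 'I_w) := split (q' (unsplit a) (unsplit b)).
have ciq : ci_op q.
  split=> [a b c|a b|a]; rewrite /q.
  - by move/(can_inj splitK)/jq/(can_inj unsplitK).
  - by rewrite cq.
  - by rewrite iq unsplitK.
have clq a b : exists c, q (inr a) (inr b) = inr c.
  rewrite /q; case: split_ordP => [k E|k _]; last by exists k.
  have := clq0 (h + a) (h + b); rewrite !ltn_add2l !leq_addr !ltn_ord => /(_ isT isT).
  by rewrite -(q'E (rshift h a) (rshift h b)) E /= leqNgt ltn_ord.
pose g0 i j := wrap h (i + j) h.
have bg0 i j : i < h -> j < h -> g0 i j < h by rewrite /g0 /wrap; case: ifP; lia.
have gE (i j : 'I_h) : insubd i (g0 i j) = g0 i j :> nat by rewrite val_insubd bg0.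
pose g (i j : 'I_h) := insubd i (g0 i j).
have jg i : injective (g i).
  move=> j k /(congr1 val); rewrite /= !gE /g0 /wrap => E; apply: val_inj => /=.
  by move: E (ltn_ord i) (ltn_ord j) (ltn_ord k); do 2!case: ifP; lia.
have cg : commutative g by move=> i j; apply: val_inj; rewrite /= !gE /g0 addnC.
exists (M * 'I_h + 'I_w)%type; split; first by rewrite card_sum card_prod !card_ord Mm.
exists (inflate f q g); first exact: inflate_ci.
by apply: inflate_covering; rewrite ?card_ord ?Mm.
Qed.

(* the half of [x + y] modulo the odd number [w] *)
Definition half_sum w x y :=
  if ~~ odd (x + y) then (x + y)./2
  else if w <= x + y then (x + y - w)./2 else (x + y + w)./2.

Lemma half_sum_lt w x y : odd w -> x < w -> y < w -> half_sum w x y < w.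
Proof. by rewrite /half_sum => ow xw yw; do !case: ifP; lia. Qed.

Lemma half_sum_inj w x y z : odd w -> x < w -> y < w -> z < w ->
  half_sum w x y = half_sum w x z -> y = z.
Proof. by rewrite /half_sum => ow xw yw zw; do !case: ifP; lia. Qed.

(* A commutative idempotent square on Z_h and [w] further points, for
   [h = w + 2 (t + s) + 1] with [t] the largest integer such that [2 t < h / 2]:
   [x, x + 2 e |-> x + e] for [|e| <= t],
   [x, x + 2 j - 1 |-> x + j - (s + t + 1)] for [1 - s <= j <= s],
   [x, h + k |-> x + t + 1 + k].
   The remaining pairs of Z_h have an odd difference or the difference [h / 2].
   For each odd residue [e] the pairs [x, x + e] with [x] even form a perfect
   matching, so these residues are the symbols used there. *)
Definition zigzag h w s t x y :=
  let lo := minn x y in let hi := maxn x y in let d := hi - lo in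
  if ~~ odd d then
    if d <= t.*2 then lo + d./2
    else if h - d <= t.*2 then wrap h (hi + (h - d)./2) h
    else h + w.-1
  else if d < s.*2 then wrap h (lo + d.+1./2) (s + t).+1
  else if h - d < s.*2 then wrap h (hi + (h - d).+1./2) (s + t).+1
  else h + ((if odd lo then h - d else d) - s.*2)./2.

Definition incomplete_op h w s t x y :=
  if x < h then
    if y < h then zigzag h w s t x y else wrap h (x + (t + (y - h)).+1) h
  else if y < h then wrap h (y + (t + (x - h)).+1) h
  else h + half_sum w (x - h) (y - h).

(* [d] is the residue of [y - x] modulo [h], and [o] that of [z - x] when the
   symbol [z] lies in Z_h. *)
Lemma zigzagP h w s t x y :
  h = t.*2.*2.+2 \/ h = t.*2.*2 + 4 -> h = w + (t + s).*2.+1 ->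
  x < h -> y < h ->
  exists2 d, d < h & (y = x + d \/ y + h = x + d) /\
  ((exists o, [/\ o < h, zigzag h w s t x y < h,
      zigzag h w s t x y = x + o \/ zigzag h w s t x y + h = x + o &
      (o <= t \/ h <= o + t) /\ (d = o.*2 \/ d + h = o.*2) \/
      h <= o + t + s.*2 /\ o + t < h /\ (d + w = o.*2 \/ d + w + h = o.*2)]) \/
   (exists2 i, zigzag h w s t x y = h + i &
      i < w /\
      ((s + s + i).*2.+1 < h /\
       d = (if odd x then h - (s + i).*2.+1 else (s + i).*2.+1) \/
       d.*2 = h /\ i.+1 = w /\ ~~ odd d))).
Proof.
move=> hh hw xh yh; rewrite /zigzag /wrap.
exists (if x <= y then y - x else y + h - x); first by case: ifP; lia.
case: (leqP x y) => xy; split; try lia.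
- case: ifP => od.
    case: ifP => dt.
      by left; exists (y - x)./2; split; lia.
    case: ifP => dt'.
      by left; exists (h - (h - (y - x))./2); case: ifP; split; lia.
    by right; exists w.-1; lia.
  case: ifP => ds.
    by left; exists (h + (y - x).+1./2 - (s + t).+1); case: ifP; split; lia.
  case: ifP => ds'.
    by left; exists (y - x + (h - (y - x)).+1./2 - (s + t).+1); case: ifP; split; lia.
  by right; case: ifP; eexists; try reflexivity; lia.
- case: ifP => od.
    case: ifP => dt.
      by left; exists (h - (x - y)./2); split; lia.
    case: ifP => dt'.
      by left; exists ((h - (x - y))./2); case: ifP; split; lia.
    by right; exists w.-1; lia.
  case: ifP => ds.
    by left; exists (h - (x - y) + (x - y).+1./2 - (s + t).+1); case: ifP; split; lia.
  case: ifP => ds'.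
    by left; exists (h + (h - (x - y)).+1./2 - (s + t).+1); case: ifP; split; lia.
  by right; case: ifP => oy; case ox: (odd x); eexists; try reflexivity; lia.
Qed.

(** For fixed [x] the symbol reveals the family: small even differences give offsets within [t] of
    0, small odd ones offsets from [-(t + 2 s)] to [-(t + 1)], and a symbol [h + i] names a perfect
    matching. *)
Lemma zigzag_inj h w s t x y z :
  h = t.*2.*2.+2 \/ h = t.*2.*2 + 4 -> h = w + (t + s).*2.+1 ->
  x < h -> y < h -> z < h -> zigzag h w s t x y = zigzag h w s t x z -> y = z.
Proof.
move=> hh hw xh yh zh.
case: (zigzagP hh hw xh yh) => d dh [yd H].
case: (zigzagP hh hw xh zh) => e eh [ze K] E.
move: H K; rewrite -{}E; move: (zigzag h w s t x y) => v.
case: (odd x).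
all: case=> [[o [oh vh vo [[ot od]|[o1 [o2 od]]]]]|[i vi [iw od]]].
all: case=> [[p [ph vh' vp [[pt pd]|[p1 [p2 pd]]]]]|[j vj [jw pd]]].
all: lia.
Qed.

Lemma half_sum_ci w : odd w -> ci_on w (half_sum w).
Proof.
move=> ow; split=> [x y xw yw|x y xw yw|x xw|x y z xw yw zw].
- exact: half_sum_lt.
- by rewrite /half_sum addnC.
- by rewrite /half_sum addnn odd_double doubleK.
- exact: half_sum_inj.
Qed.

Lemma incomplete_odd h : odd h -> incomplete h 0.
Proof.
move=> oh; exists (half_sum h); first by rewrite addn0; apply: half_sum_ci.
by move=> x y; rewrite addn0; lia.
Qed.

Lemma incomplete_even h w :
  0 < h -> ~~ odd h -> odd w -> w <= (h./2)./2.*2.+1 -> incomplete h w.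
Proof.
(* The bound on [w] keeps the subtraction in [s] from truncating. *)
move=> h0 eh ow wh; pose t := (h./2).-1./2; pose s := (h - w - t.*2.+1)./2.
have hh : h = t.*2.*2.+2 \/ h = t.*2.*2 + 4 by rewrite /t; lia.
have hw : h = w + (t + s).*2.+1 by rewrite /s; lia.
move: {eh wh} t s hh hw => t s hh hw.
have [bH cH iH jH] := half_sum_ci ow.
have jZ := @zigzag_inj h w s t _ _ _ hh hw.
have zP := @zigzagP h w s t _ _ hh hw.
(* The offsets [t + 1] to [t + w] are those that [zigzag] leaves free. *)
have mix x y z : x < h -> y < h -> h <= z < h + w ->
    zigzag h w s t x y <> wrap h (x + (t + (z - h)).+1) h.
  move=> xh yh zn; have [d _ [_ [[o [? ? ? ?]]|[i -> _]]]] := zP _ _ xh yh;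
    by rewrite /wrap; case: ifP; lia.
exists (incomplete_op h w s t); last first.
  by move=> x y hx hy; rewrite /incomplete_op; case: ifP; [lia | case: ifP; lia].
split=> [x y xn yn|x y xn yn|x xn|x y z xn yn zn]; rewrite /incomplete_op.
- case: ifP => xh; case: ifP => yh.
  + by have [d _ [_ [[o []]|[i]]]] := zP _ _ xh yh; lia.
  + by rewrite /wrap; case: ifP; lia.
  + by rewrite /wrap; case: ifP; lia.
  + by rewrite ltn_add2l bH; lia.
- case: ifP => xh; case: ifP => yh //; last by rewrite cH; lia.
  by rewrite /zigzag minnC maxnC.
- case: (ltnP x h) => xh; last by rewrite iH; lia.
  by rewrite /zigzag minnn maxnn subnn addn0.
- case: (ltnP x h) => xh; last first.
    case: ifP => yh; case: ifP => zh.
    + by rewrite /wrap; do 2?case: ifP; lia.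
    + by rewrite /wrap; case: ifP; lia.
    + by rewrite /wrap; case: ifP; lia.
    + by move/addnI/jH; lia.
  case: ifP => yh; case: ifP => zh; first exact: jZ.
  + by move/mix; case; lia.
  + by move/esym/mix; case; lia.
  + by rewrite /wrap; do 2?case: ifP; lia.
Qed.

(** * Squares verified by computation *)

Definition table := seq (seq nat).

Definition entry (t : table) i j := nth 0 (nth [::] t i) j.

Definition tabulate n (f : nat -> nat -> nat) : table :=
  [seq mkseq (f i) n | i <- iota 0 n].

Definition ci_table n (t : table) :=
  [&& size t == n,
      all (fun r => [&& size r == n, all (gtn n) r & uniq r]) t,
      all (fun i => entry t i i == i) (iota 0 n) &
      all (fun i => all (fun j => entry t i j == entry t j i) (iota 0 n))
        (iota 0 n)].

(* the rows, columns and symbols of a subsquare *)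
Definition certificate := (bitseq * bitseq * bitseq)%type.

Definition flat (m : bitseq) : certificate := (m, m, m).

Definition mask_of n (s : seq nat) : bitseq := mkseq (fun i => i \in s) n.

Definition valid_certificate n (t : table) (c : certificate) :=
  let: (R, C, U) := c in
  [&& size R == n, size C == n, size U == n,
      count id R == count id C, count id U == count id R,
      all (fun rt : bool * seq nat => rt.1 ==>
        all (fun cv : bool * nat => cv.1 ==> nth false U cv.2) (zip C rt.2))
        (zip R t) &
      [&& R == C, C == U & ~~ all id R] ||
      ~~ has (fun b : bool * bool => b.1 && b.2) (zip R C)].

Definition or_masks n (ms : seq bitseq) : bitseq :=
  foldr (fun m acc => [seq b.1 || b.2 | b <- zip m acc]) (nseq n false) ms.

Definition certificates_cover n (cs : seq certificate) :=
  all (fun r => let cr := [seq c <- cs | nth false c.1.1 r] in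
    all (fun k =>
      or_masks n [seq c.2 | c <- cr & nth false c.1.2 k] == nseq n true)
      (iota 0 n)) (iota 0 n).

Definition covered_table n t cs :=
  [&& ci_table n t, all (valid_certificate n t) cs & certificates_cover n cs].

Lemma ci_table_on n t : ci_table n t -> ci_on n (entry t).
Proof.
case/and4P=> /eqP st /allP rt /allP it /allP ct.
have row i : i < n -> nth [::] t i \in t by move=> lin; rewrite mem_nth ?st.
split=> [x y xn yn|x y xn yn|x xn|x y z xn yn zn].
- have /and3P[/eqP sr /allP br _] := rt _ (row x xn).
  by apply: br; rewrite mem_nth ?sr.
- have /allP cx := ct x ltac:(by rewrite mem_iota).
  by apply/eqP/cx; rewrite mem_iota.
- by apply/eqP/it; rewrite mem_iota.
- have /and3P[/eqP sr _ ur] := rt _ (row x xn).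
  by move/eqP; rewrite /entry nth_uniq ?sr // => /eqP.
Qed.

Lemma incomplete_table h w t : ci_table (h + w) t ->
  all (fun i => all (fun j => h <= entry t i j) (iota h w)) (iota h w) ->
  incomplete h w.
Proof.
move=> cit /allP cl; exists (entry t); first exact: ci_table_on.
move=> x y hx hy; have /allP clx := cl x ltac:(by rewrite mem_iota).
by apply: clx; rewrite mem_iota.
Qed.

Lemma card_mask n (m : bitseq) : size m = n ->
  #|[set i : 'I_n | nth false m i]| = count id m.
Proof.
move=> sm; rewrite cardsE cardE /enum_mem size_filter -enumT.
rewrite -[in RHS](mkseq_nth false m) sm /mkseq -val_enum_ord -map_comp count_map.
by apply: eq_count.
Qed.

Lemma nth_or_masks n ms i : nth false (or_masks n ms) i ->
  has (fun m => nth false m i) ms.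
Proof.
elim: ms => [|m ms IHms] /=; first by rewrite nth_nseq if_same.
set acc := or_masks n ms.
have [iz|iz] := ltnP i (size (zip m acc)); last by rewrite nth_default ?size_map.
rewrite (nth_map (false, false)) // nth_zip_cond iz /=.
by case/orP=> [->|/IHms ->]; rewrite ?orbT.
Qed.

Lemma covered_table_covered n t cs : covered_table n t cs -> covered n.
Proof.
case/and3P=> cit /allP valid /allP cov.
have [op ciop opE] := ci_on_op (ci_table_on cit).
exists 'I_n; split; first exact: card_ord.
exists op => // r c u.
have /allP covr := cov r ltac:(by rewrite mem_iota ltn_ord).
have /eqP covc := covr c ltac:(by rewrite mem_iota ltn_ord).
have /nth_or_masks : nth false (or_masks n
    [seq x.2 | x <- [seq x <- cs | nth false x.1.1 r] & nth false x.1.2 c]) u.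
  by rewrite covc nth_nseq ltn_ord.
case/hasP=> m /mapP[x]; rewrite !mem_filter => /and3P[xc xr xin] -> xu.
have := valid x xin; case: x xc xr xu {xin} => [[R C] U] /= cC rR uU.
case/and5P=> /eqP sR /eqP sC /eqP sU /eqP cRC /and3P[/eqP cUR /all_nthP cl pr].
pose set_of (b : bitseq) := [set i : 'I_n | nth false b i].
exists (set_of R), (set_of C), (set_of U); rewrite !inE; split=> //.
have /and4P[/eqP st /allP rt _ _] := cit.
split; rewrite ?card_mask //.
  move=> i j; rewrite !inE => iR jC.
  have := cl (false, [::]) i; rewrite size_zip sR st minnn ltn_ord => /(_ isT).
  rewrite nth_zip ?sR // iR /= => /(all_nthP (false, 0))/(_ j).
  have /and3P[/eqP srow _ _] := rt _ (mem_nth [::] (ltac:(by rewrite st) : i < size t)).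
  by rewrite size_zip sC srow minnn ltn_ord nth_zip ?sC // jC opE => /(_ isT).
case/orP: pr => [/and3P[/eqP RC /eqP CU nR]|/hasPn dis]; [left | right].
  rewrite -CU -RC; split=> //; apply: contra nR => /eqP/setP RT.
  by apply/(all_nthP false)=> i; rewrite sR => lin; have := RT (Ordinal lin); rewrite !inE.
apply/pred0P=> i /=; rewrite !inE; apply/negP=> iRC.
have := dis (nth (false, false) (zip R C) i); rewrite mem_nth ?size_zip ?sR ?sC ?minnn //.
by rewrite nth_zip ?sR ?sC //= iRC => /(_ isT).
Qed.

(* A vector of F_b^k is coded by the number with its coordinates as base [b]
   digits; this is [- x - y]. *)
Fixpoint neg_sum b k x y :=
  if k is k'.+1 then
    (2 * b - (x %% b + y %% b)) %% b + b * neg_sum b k' (x %/ b) (y %/ b)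
  else 0.

Definition table5 := tabulate 5 (half_sum 5).

(* The Fano plane: [i] stands for the vector coded [i + 1] in F_2^3. *)
Definition table7 :=
  tabulate 7 (fun x y => if x == y then x else (neg_sum 2 3 x.+1 y.+1).-1).

(** For distinct [r] and [c], a symbol [u] off their line is reached with [d = r + c + u]; as [d] is
    off that line too, rows and columns are disjoint. *)
Definition certificates7 :=
  let op := entry table7 in
  let pairs := [seq (x, y) | x <- iota 0 7, y <- iota 0 7] in
  [seq flat (mask_of 7 [:: p.1; p.2; op p.1 p.2]) | p <- pairs] ++
  [seq (mask_of 7 [:: p.1; op p.1 d], mask_of 7 [:: p.2; op p.2 d],
        mask_of 7 [:: op p.1 p.2; op (op p.1 p.2) d])
  | p <- pairs, d <- [seq d <- iota 0 7 | uniq [:: p.1; p.2; op p.1 p.2; d]]].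

Lemma covered7 : covered 7.
Proof. by apply: (@covered_table_covered 7 table7 certificates7); vm_compute. Qed.

Definition table9 := tabulate 9 (neg_sum 3 2).

(** Since [neg_sum 3 2 0] is negation, [y] is [x + d]. *)
Definition line9 d x :=
  let y := neg_sum 3 2 0 (neg_sum 3 2 x d) in [:: x; y; neg_sum 3 2 x y].

(* representatives of the four directions of AG(2,3) *)
Definition directions9 := [:: 1; 3; 4; 5].

Definition certificates9 :=
  let coset d x := mask_of 9 (line9 d x) in
  [seq (coset d p.1, coset d p.2, coset d (neg_sum 3 2 p.1 p.2))
  | p <- [seq (x, y) | x <- iota 0 9, y <- iota 0 9], d <- directions9].

Lemma covered9 : covered 9.
Proof. by apply: (@covered_table_covered 9 table9 certificates9); vm_compute. Qed.

(* The tables of orders 11, 13 and 15 were found by computer search.  Each has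
   the subsquare [table5] on 0..4, and the point 0 also forms a subsquare with
   each of the groups 5..6, 7..8, 9..10 (order 11), 5..8, 9..12 (orders 13, 15)
   and 13..14 (order 15); with the groups of size 4 it is a copy of [table5]. *)
Definition table11 : table :=
  [:: [:: 0; 3; 1; 4; 2; 6; 5; 8; 7; 10; 9];
      [:: 3; 1; 4; 2; 0; 9; 7; 6; 10; 8; 5];
      [:: 1; 4; 2; 0; 3; 10; 9; 5; 6; 7; 8];
      [:: 4; 2; 0; 3; 1; 7; 8; 10; 9; 5; 6];
      [:: 2; 0; 3; 1; 4; 8; 10; 9; 5; 6; 7];
      [:: 6; 9; 10; 7; 8; 5; 0; 3; 4; 2; 1];
      [:: 5; 7; 9; 8; 10; 0; 6; 2; 1; 4; 3];
      [:: 8; 6; 5; 10; 9; 3; 2; 7; 0; 1; 4];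
      [:: 7; 10; 6; 9; 5; 4; 1; 0; 8; 3; 2];
      [:: 10; 8; 7; 5; 6; 2; 4; 1; 3; 9; 0];
      [:: 9; 5; 8; 6; 7; 1; 3; 4; 2; 0; 10]].

Definition table13 : table :=
  [:: [:: 0; 3; 1; 4; 2; 7; 5; 8; 6; 11; 9; 12; 10];
      [:: 3; 1; 4; 2; 0; 11; 9; 10; 12; 7; 8; 6; 5];
      [:: 1; 4; 2; 0; 3; 9; 12; 11; 10; 8; 5; 7; 6];
      [:: 4; 2; 0; 3; 1; 12; 10; 9; 11; 5; 6; 8; 7];
      [:: 2; 0; 3; 1; 4; 10; 11; 12; 9; 6; 7; 5; 8];
      [:: 7; 11; 9; 12; 10; 5; 8; 6; 0; 2; 1; 3; 4];
      [:: 5; 9; 12; 10; 11; 8; 6; 0; 7; 3; 2; 4; 1];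
      [:: 8; 10; 11; 9; 12; 6; 0; 7; 5; 1; 4; 2; 3];
      [:: 6; 12; 10; 11; 9; 0; 7; 5; 8; 4; 3; 1; 2];
      [:: 11; 7; 8; 5; 6; 2; 3; 1; 4; 9; 12; 10; 0];
      [:: 9; 8; 5; 6; 7; 1; 2; 4; 3; 12; 10; 0; 11];
      [:: 12; 6; 7; 8; 5; 3; 4; 2; 1; 10; 0; 11; 9];
      [:: 10; 5; 6; 7; 8; 4; 1; 3; 2; 0; 11; 9; 12]].

Definition table15 : table :=
  [:: [:: 0; 3; 1; 4; 2; 7; 5; 8; 6; 11; 9; 12; 10; 14; 13];
      [:: 3; 1; 4; 2; 0; 13; 9; 14; 12; 6; 8; 7; 5; 11; 10];
      [:: 1; 4; 2; 0; 3; 9; 10; 11; 14; 7; 5; 13; 8; 6; 12];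
      [:: 4; 2; 0; 3; 1; 11; 12; 10; 13; 5; 7; 14; 6; 8; 9];
      [:: 2; 0; 3; 1; 4; 12; 11; 9; 10; 13; 6; 8; 14; 7; 5];
      [:: 7; 13; 9; 11; 12; 5; 8; 6; 0; 1; 14; 4; 2; 10; 3];
      [:: 5; 9; 10; 12; 11; 8; 6; 0; 7; 14; 3; 2; 13; 4; 1];
      [:: 8; 14; 11; 10; 9; 6; 0; 7; 5; 4; 13; 1; 3; 12; 2];
      [:: 6; 12; 14; 13; 10; 0; 7; 5; 8; 2; 1; 3; 4; 9; 11];
      [:: 11; 6; 7; 5; 13; 1; 14; 4; 2; 9; 12; 10; 0; 3; 8];
      [:: 9; 8; 5; 7; 6; 14; 3; 13; 1; 12; 10; 0; 11; 2; 4];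
      [:: 12; 7; 13; 14; 8; 4; 2; 1; 3; 10; 0; 11; 9; 5; 6];
      [:: 10; 5; 8; 6; 14; 2; 13; 3; 4; 0; 11; 9; 12; 1; 7];
      [:: 14; 11; 6; 8; 7; 10; 4; 12; 9; 3; 2; 5; 1; 13; 0];
      [:: 13; 10; 12; 9; 5; 3; 1; 2; 11; 8; 4; 6; 7; 0; 14]].

(** * Squares assembled from blocks *)

Definition ingredient k : table :=
  match k with
  | 5 => table5 | 7 => table7 | 9 => table9
  | 11 => table11 | 13 => table13 | 15 => table15
  | _ => [::]
  end.

(* Blocks may share more than one point, provided that the copies of the
   ingredients agree there: the first block containing both points is used. *)
Definition block_table n (blocks : seq (seq nat)) (other : nat -> nat -> nat) : table :=
  [seq let bs := [seq b <- blocks | x \in b] in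
       mkseq (fun y =>
         if [seq b <- bs | y \in b] is b :: _
         then nth 0 b (entry (ingredient (size b)) (index x b) (index y b))
         else other x y) n
  | x <- iota 0 n].

(* Three copies [i h + v] of a vector space with [h] elements [v], and [w] common
   points [3 h + k]; the table [q] lives on one copy and the common points, which
   it codes [h + k]. *)
Definition triple_table h w (q : table) (vsum : nat -> nat -> nat) : table :=
  let embed i z := if z < h then i * h + z else 2 * h + z in
  let local x := if x < 3 * h then x %% h else x - 2 * h in
  tabulate (3 * h + w) (fun x y =>
    if [&& x < 3 * h, y < 3 * h & x %/ h != y %/ h] then
      neg_sum 3 1 (x %/ h) (y %/ h) * h + vsum (x %% h) (y %% h)
    else embed (minn x y %/ h) (entry q (local x) (local y))).

(* The planes: a copy with the common points, or two parallel blocks in the first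
   two copies with their sum in the third. *)
Definition triple_certificates h w (blocks : seq (seq nat)) vsum :=
  let n := 3 * h + w in
  [seq flat (mkseq (fun x => (x %/ h == i) || (3 * h <= x)) n) | i <- iota 0 3] ++
  [seq let v1 := [seq x <- p.1 | x < h] in
       let v2 := [seq x <- p.2 | x < h] in
       flat (mask_of n
         (v1 ++ [seq h + x | x <- v2] ++
          [seq 2 * h + x | x <- undup [seq vsum x y | x <- v1, y <- v2]] ++
          [seq 2 * h + x | x <- p.1 & h <= x]))
  | p <- [seq (b1, b2) | b1 <- blocks, b2 <- blocks]
    & [seq x <- p.1 | h <= x] == [seq x <- p.2 | h <= x]].

Definition triple_check h w blocks vsum :=
  covered_table (3 * h + w)
    (triple_table h w (block_table (h + w) blocks (fun _ _ => 0)) vsum)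
    (triple_certificates h w blocks vsum).

(* The lines of PG(2,4): AG(2,4) on 0..15 and the line at infinity on 16..20.  The
   square of order 53 is then a union of three planes of PG(3,4) through a line. *)
Definition blocks21 : seq (seq nat) :=
  [:: [:: 16; 17; 18; 19; 20]; [:: 0; 1; 2; 3; 16]; [:: 4; 5; 6; 7; 16]; [:: 8; 9; 10; 11; 16];
      [:: 12; 13; 14; 15; 16]; [:: 0; 5; 10; 15; 17]; [:: 4; 1; 14; 11; 17]; [:: 8; 13; 2; 7; 17];
      [:: 12; 9; 6; 3; 17]; [:: 0; 9; 14; 7; 18]; [:: 4; 13; 10; 3; 18]; [:: 8; 1; 6; 15; 18];
      [:: 12; 5; 2; 11; 18]; [:: 0; 13; 6; 11; 19]; [:: 4; 9; 2; 15; 19]; [:: 8; 5; 14; 3; 19];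
      [:: 12; 1; 10; 7; 19]; [:: 0; 4; 8; 12; 20]; [:: 1; 5; 9; 13; 20]; [:: 2; 6; 10; 14; 20];
      [:: 3; 7; 11; 15; 20]].

Lemma covered53 : covered 53.
Proof.
have: triple_check 16 5 blocks21 (neg_sum 2 4) by vm_compute.
exact: covered_table_covered.
Qed.

(* AG(3,3) as three parallel planes, every point [g] of which is doubled to
   [2 g], [2 g + 1]; the point 18 of a plane's own numbering is the third point of
   the lines on these pairs.  The points at infinity of the directions of the
   planes are replaced by the groups [infs]. *)
Definition weighted_blocks (infs : seq (seq nat)) : seq (seq nat) :=
  let double l i := (nth 0 l i).*2 in
  (18 :: flatten infs) ::
  flatten [seq
    [seq 18 :: di.2 ++
       (let p := double (line9 di.1 x) in
        if size di.2 == 2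
        then [:: p 0; p 1; p 2; (p 0).+1; (p 2).+1; (p 1).+1]
        else [:: p 0; (p 0).+1; p 1; (p 1).+1; p 2; (p 2).+1])
    | x <- if di.1 == 1 then [:: 0; 3; 6] else iota 0 3]
  | di <- zip directions9 infs].

Definition double_sum x y := (neg_sum 3 2 x./2 y./2).*2 + (odd x (+) odd y).

Lemma covered65 : covered 65.
Proof.
(* Groups of size 4 and 2 give blocks of order 11 and 9. In order 9 the points are listed so that
   each doubled pair is collinear in [table9] with 18, the first point. *)
pose blocks := weighted_blocks [:: iota 19 4; iota 23 2; iota 25 2; iota 27 2].
have: triple_check 18 11 blocks double_sum by vm_compute.
exact: covered_table_covered.
Qed.

Lemma covered67 : covered 67.
Proof.
pose blocks := weighted_blocks [:: iota 19 4; iota 23 4; iota 27 4; [::]].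
have: triple_check 18 13 blocks double_sum by vm_compute.
exact: covered_table_covered.
Qed.

Lemma covered69 : covered 69.
Proof.
pose blocks := weighted_blocks [:: iota 19 4; iota 23 4; iota 27 4; iota 31 2].
have: triple_check 18 15 blocks double_sum by vm_compute.
exact: covered_table_covered.
Qed.

(* the vectors of F_3^k with leading digit 1 *)
Definition projective_points k := flatten [seq iota (3 ^ i) (3 ^ i) | i <- iota 0 k].

(* F_3^4 with two further points 81, 82: together with the line 0, 1, 2 these form
   a subsquare of order 5, and each plane through this line is replaced by a
   square of order 11. *)
Definition blocks83 : seq (seq nat) :=
  let opp := neg_sum 3 4 0 in
  [seq let x := 3 * u in
       [:: 0; 1; 2; 81; 82; x; opp x; x.+1; opp x.+1; x.+2; opp x.+2]
  | u <- projective_points 3].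

Fixpoint dot3 k x y :=
  if k is k'.+1 then (x %% 3) * (y %% 3) + dot3 k' (x %/ 3) (y %/ 3) else 0.

Definition certificates83 :=
  [seq flat (mkseq (fun x => (if x < 81 then dot3 4 a x else a) %% 3 == 0) 83)
  | a <- projective_points 4].

Lemma covered83 : covered 83.
Proof.
pose t := block_table 83 blocks83 (neg_sum 3 4).
have: covered_table 83 t certificates83 by vm_compute.
exact: covered_table_covered.
Qed.

(* Both were found by computer search; the last 7, respectively 11, points form a
   subsquare. *)
Definition table17 : table :=
  [:: [:: 0; 13; 12; 6; 10; 4; 14; 16; 11; 15; 8; 7; 2; 5; 9; 3; 1];
      [:: 13; 1; 16; 10; 15; 12; 9; 2; 14; 11; 5; 0; 8; 7; 6; 4; 3];
      [:: 12; 16; 2; 11; 13; 3; 15; 14; 10; 8; 0; 4; 9; 1; 7; 6; 5];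
      [:: 6; 10; 11; 3; 14; 13; 12; 15; 16; 7; 4; 2; 5; 0; 8; 1; 9];
      [:: 10; 15; 13; 14; 4; 16; 11; 0; 5; 12; 2; 8; 7; 3; 1; 9; 6];
      [:: 4; 12; 3; 13; 16; 5; 10; 11; 15; 14; 1; 9; 6; 8; 0; 7; 2];
      [:: 14; 9; 15; 12; 11; 10; 6; 13; 1; 16; 3; 5; 0; 2; 4; 8; 7];
      [:: 16; 2; 14; 15; 0; 11; 13; 7; 12; 10; 9; 1; 4; 6; 3; 5; 8];
      [:: 11; 14; 10; 16; 5; 15; 1; 12; 8; 13; 7; 6; 3; 9; 2; 0; 4];
      [:: 15; 11; 8; 7; 12; 14; 16; 10; 13; 9; 6; 3; 1; 4; 5; 2; 0];
      [:: 8; 5; 0; 4; 2; 1; 3; 9; 7; 6; 10; 14; 11; 15; 12; 16; 13];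
      [:: 7; 0; 4; 2; 8; 9; 5; 1; 6; 3; 14; 11; 15; 12; 16; 13; 10];
      [:: 2; 8; 9; 5; 7; 6; 0; 4; 3; 1; 11; 15; 12; 16; 13; 10; 14];
      [:: 5; 7; 1; 0; 3; 8; 2; 6; 9; 4; 15; 12; 16; 13; 10; 14; 11];
      [:: 9; 6; 7; 8; 1; 0; 4; 3; 2; 5; 12; 16; 13; 10; 14; 11; 15];
      [:: 3; 4; 6; 1; 9; 7; 8; 5; 0; 2; 16; 13; 10; 14; 11; 15; 12];
      [:: 1; 3; 5; 9; 6; 2; 7; 8; 4; 0; 13; 10; 14; 11; 15; 12; 16]].

Definition table25 : table :=
  [:: [:: 0; 18; 24; 2; 22; 6; 21; 20; 16; 14; 15; 19; 23; 17; 13; 7; 4; 3; 11; 1; 12; 5; 9; 10; 8];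
      [:: 18; 1; 16; 17; 23; 20; 15; 19; 21; 22; 7; 13; 24; 14; 5; 9; 3; 10; 2; 4; 0; 11; 6; 8; 12];
      [:: 24; 16; 2; 11; 20; 21; 14; 0; 19; 15; 23; 17; 22; 18; 3; 4; 13; 8; 12; 5; 7; 6; 1; 9; 10];
      [:: 2; 17; 11; 3; 21; 15; 22; 14; 23; 19; 24; 18; 20; 16; 12; 13; 9; 7; 0; 10; 5; 4; 8; 6; 1];
      [:: 22; 23; 20; 21; 4; 17; 18; 16; 15; 24; 9; 5; 14; 19; 11; 12; 1; 13; 6; 8; 2; 7; 10; 3; 0];
      [:: 6; 20; 21; 15; 17; 5; 24; 22; 14; 18; 19; 23; 16; 4; 0; 8; 10; 11; 7; 9; 1; 12; 3; 2; 13];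
      [:: 21; 15; 14; 22; 18; 24; 6; 17; 12; 23; 20; 16; 19; 10; 1; 2; 7; 5; 8; 11; 9; 3; 0; 13; 4];
      [:: 20; 19; 0; 14; 16; 22; 17; 7; 24; 8; 21; 15; 18; 23; 10; 5; 12; 9; 4; 3; 6; 1; 13; 11; 2];
      [:: 16; 21; 19; 23; 15; 14; 12; 24; 8; 17; 18; 22; 1; 20; 6; 3; 11; 0; 5; 13; 10; 9; 2; 4; 7];
      [:: 14; 22; 15; 19; 24; 18; 23; 8; 17; 9; 16; 20; 3; 21; 2; 0; 6; 12; 10; 7; 4; 13; 5; 1; 11];
      [:: 15; 7; 23; 24; 9; 19; 20; 21; 18; 16; 10; 14; 17; 22; 8; 6; 5; 4; 1; 12; 13; 2; 11; 0; 3];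
      [:: 19; 13; 17; 18; 5; 23; 16; 15; 22; 20; 14; 11; 21; 24; 4; 10; 2; 1; 9; 0; 3; 8; 7; 12; 6];
      [:: 23; 24; 22; 20; 14; 16; 19; 18; 1; 3; 17; 21; 12; 15; 7; 11; 0; 6; 13; 2; 8; 10; 4; 5; 9];
      [:: 17; 14; 18; 16; 19; 4; 10; 23; 20; 21; 22; 24; 15; 13; 9; 1; 8; 2; 3; 6; 11; 0; 12; 7; 5];
      [:: 13; 5; 3; 12; 11; 0; 1; 10; 6; 2; 8; 4; 7; 9; 14; 20; 15; 21; 16; 22; 17; 23; 18; 24; 19];
      [:: 7; 9; 4; 13; 12; 8; 2; 5; 3; 0; 6; 10; 11; 1; 20; 15; 21; 16; 22; 17; 23; 18; 24; 19; 14];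
      [:: 4; 3; 13; 9; 1; 10; 7; 12; 11; 6; 5; 2; 0; 8; 15; 21; 16; 22; 17; 23; 18; 24; 19; 14; 20];
      [:: 3; 10; 8; 7; 13; 11; 5; 9; 0; 12; 4; 1; 6; 2; 21; 16; 22; 17; 23; 18; 24; 19; 14; 20; 15];
      [:: 11; 2; 12; 0; 6; 7; 8; 4; 5; 10; 1; 9; 13; 3; 16; 22; 17; 23; 18; 24; 19; 14; 20; 15; 21];
      [:: 1; 4; 5; 10; 8; 9; 11; 3; 13; 7; 12; 0; 2; 6; 22; 17; 23; 18; 24; 19; 14; 20; 15; 21; 16];
      [:: 12; 0; 7; 5; 2; 1; 9; 6; 10; 4; 13; 3; 8; 11; 17; 23; 18; 24; 19; 14; 20; 15; 21; 16; 22];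
      [:: 5; 11; 6; 4; 7; 12; 3; 1; 9; 13; 2; 8; 10; 0; 23; 18; 24; 19; 14; 20; 15; 21; 16; 22; 17];
      [:: 9; 6; 1; 8; 10; 3; 0; 13; 2; 5; 11; 7; 4; 12; 18; 24; 19; 14; 20; 15; 21; 16; 22; 17; 23];
      [:: 10; 8; 9; 6; 3; 2; 13; 11; 4; 1; 0; 12; 5; 7; 24; 19; 14; 20; 15; 21; 16; 22; 17; 23; 18];
      [:: 8; 12; 10; 1; 0; 13; 4; 2; 7; 11; 3; 6; 9; 5; 19; 14; 20; 15; 21; 16; 22; 17; 23; 18; 24]].

(** For [h] = 10 and 14 the cyclic construction stops at [w] = 5 and 7; the two tables serve 97 = 9
    * 10 + 7 and 137 = 9 * 14 + 11. *)
Lemma incomplete_10_7 : incomplete 10 7.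
Proof. by apply: (@incomplete_table 10 7 table17); vm_compute. Qed.

Lemma incomplete_14_11 : incomplete 14 11.
Proof. by apply: (@incomplete_table 14 11 table25); vm_compute. Qed.

(** * All orders *)

Definition admissible h w :=
  (0 < h) && (if odd h then w == 0 else odd w && (w <= (h./2)./2.*2.+1)).

Lemma incomplete_admissible h w : admissible h w -> incomplete h w.
Proof.
case/andP=> h0; case: ifP => [oh /eqP ->|/negbT eh /andP[ow wh]].
  exact: incomplete_odd.
exact: incomplete_even.
Qed.

Definition reachable (ms : seq nat) n :=
  has (fun m => (0 < m) && has (fun h => (m * h <= n) && admissible h (n - m * h))
    (iota 1 (n %/ m))) ms.

Lemma covered_reachable ms n :
  {in ms, forall m, covered m} -> reachable ms n -> covered n.
Proof.
move=> cov /hasP[m mms /andP[m0 /hasP[h _ /andP[mh adm]]]].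
rewrite -(subnKC mh); apply: covered_inflate => //.
- by case/andP: adm.
- exact: cov.
- exact: incomplete_admissible.
Qed.

Theorem theorem5p5 (n : nat) :
  odd n -> 27 <= n -> n \notin [:: 33; 35; 37; 41; 43; 47; 51] ->
  exists L : 'I_n -> 'I_n -> 'I_n,
    [/\ latin_square L, symmetric_ls L, idempotent_ls L &
      forall r c s : 'I_n,
        exists R C S : {set 'I_n},
          [/\ latin_subsquare L R C S, proper_subsquare R C,
              r \in R, c \in C & s \in S]].
Proof.
move=> on n27 nex; apply: covered_square.
have [n183|n183] := leqP 183 n.
  (* Here [w = n %% 14] is odd and at most 13, which the bound allows once the even [h] is at least
     26. *)
  have -> : n = 7 * (n %/ 14).*2 + n %% 14 by lia.
  apply: covered_inflate => //; [lia | exact: covered7 | ].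
  by apply: incomplete_even; lia.
pose base := [:: 7; 9; 53; 65; 67; 69; 83].
have cov_base : {in base, forall m, covered m}.
  move=> m; rewrite !inE.
  by do 6?[case/orP]; move=> /eqP->; [exact: covered7 | exact: covered9
    | exact: covered53 | exact: covered65 | exact: covered67 | exact: covered69
    | exact: covered83].
pose derived := [:: 27; 31; 39; 61; 63].
have cov_derived : {in base ++ derived, forall m, covered m}.
  move=> m; rewrite mem_cat => /orP[/cov_base //|md].
  apply: (covered_reachable cov_base).
  by have/allP := (isT : all (reachable base) derived); apply.
have [->|n97] := eqVneq n 97.
  exact: (@covered_inflate 9 10 7 isT isT covered9 incomplete_10_7).
have [->|n137] := eqVneq n 137.
  exact: (@covered_inflate 9 14 11 isT isT covered9 incomplete_14_11).
apply: (covered_reachable cov_derived).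
pose ok k := [&& odd k, 27 <= k,
  k \notin [:: 33; 35; 37; 41; 43; 47; 51], k != 97 & k != 137].
have /allP all_ok : all (fun k => ok k ==> reachable (base ++ derived) k)
    (iota 0 183) by vm_compute.
by have := all_ok n; rewrite mem_iota n183 /ok on n27 nex n97 n137 => /(_ isT).
Qed.
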